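(* If $d_*\ge 0$, then the sequence $(\Phi_j(f_j))_{j\ge0}$ is nonincreasing and $$\mathbb P(\Theta=\emptyset)=\lim_{j\to\infty}\Phi_j(f_j).$$
   Context: Tree. $\mathbb N=\{1,2,\ldots\}$; $\mathcal U$ is the set of finite words over $\mathbb N$, including the empty word $\varnothing$; $\langle u\rangle$ is the length (generation) of $u$; for $u\ne\varnothing$, $\pi(u)$ is $u$ with its last letter removed. Fix integers $m_j\ge 2$ ($j\ge 0$). For $j\ge 0$, $\mathcal U_j=\{u\in\mathcal U:\ u_i\le m_{j+i-1}\text{ for }1\le i\le\langle u\rangle\}$ and $\mathcal U_j^*=\mathcal U_j\setminus\{\varnothing\}$. For $u\in\mathcal U_0$, $u\,\mathcal U_{\langle u\rangle}$ (resp. $u\,\mathcal U_{\langle u\rangle}^*$) is the set of concatenations of $u$ with words of $\mathcal U_{\langle u\rangle}$ (resp. $\mathcal U_{\langle u\rangle}^*$). Compacts. Fix $d\ge 1$, reals $0<\underline\beta\le\overline\beta<1$, and for each $j\ge0$ a probability measure $\mu_j$ on $[\underline\beta,\overline\beta]^{m_j}$. $(J_u)_{u\in\mathcal U_0}$ is a random family of compact subsets of $\mathbb R^d$ with positive diameters $|J_u|$, such that: (A) for each $u\in\mathcal U_0$, the sets $J_{uk}$, $1\le k\le m_{\langle u\rangle}$, are subsets of $J_u$ with disjoint interiors; (B) there is a real $\kappa>0$ such that for each $u\in\mathcal U_0$ the Lebesgue measure of the interior of $J_u$ is at least $\kappa|J_u|^d$; (C) the ratios $L_u=|J_u|/|J_{\pi(u)}|$,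 $u\in\mathcal U_0^*$, are random variables and the vectors $(L_{uk})_{1\le k\le m_{\langle u\rangle}}$, $u\in\mathcal U_0$, are independent with respective distributions $\mu_{\langle u\rangle}$. Markov chain. For $j\ge0$ and $t\in\{0,1\}$ let $\nu_{t,j}$ be a probability measure on $\{0,1\}^{m_j}$. $(X_u)_{u\in\mathcal U_0}$ is a family of $\{0,1\}$-valued random variables, independent of $(L_u)_{u\in\mathcal U_0^*}$, such that for every $u\in\mathcal U_0$ and $A\subseteq\{0,1\}^{m_{\langle u\rangle}}$, $\mathbb P\big((X_{uk})_{1\le k\le m_{\langle u\rangle}}\in A\mid \mathcal G_u\big)=\nu_{X_u,\langle u\rangle}(A)$, where $\mathcal G_u=\sigma(X_v,\ v\in\mathcal U_0\setminus(u\,\mathcal U^*_{\langle u\rangle}))$. The set $\Theta$. Almost surely, for every sequence $\zeta=(\zeta_j)_{j\ge1}$ in $\mathbb N$ with $\zeta_1\ldots\zeta_j\in\mathcal U_0$ for all $j\ge 1$, the set $\bigcap_{j\ge1}J_{\zeta_1\ldots\zeta_j}$ is a single point, denoted $x_\zeta$. For $u\in\mathcal U_0$ let $\tau_u=\{v\in u\,\mathcal U_{\langle u\rangle}:\ X_{v_1\ldots v_j}=1\text{ for all }\langle u\rangle\le j\le\langle v\rangle\}$, $\partial\tau_u=\{\zeta\in\mathbb N^{\mathbb N}:\ \zeta_1\ldots\zeta_j\in\tau_u\text{ for all }j\ge\langle u\rangle\}$, $K_u=\{x_\zeta:\zeta\in\partial\tau_u\}$, and $\Theta=\bigcup_{u\in\mathcal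 U_0}K_u$. The number $d_*$. For $s\in\mathbb R$ and $j\ge0$, $\alpha_{s,j}=\int_{\{0,1\}^{m_j}}\int_{[\underline\beta,\overline\beta]^{m_j}}\sum_{k=1}^{m_j}\ell_k^s x_k\,\mu_j(d\ell)\,\nu_{1,j}(dx)$. Let $\underline j=\inf\{j_0\ge0:\ \alpha_{0,j}>0\ \text{for all } j\ge j_0\}$ (with $\inf\emptyset=\infty$). If $\underline j=\infty$, $d_*=-\infty$. Otherwise let $\rho(s)=\liminf_{j\to\infty}\frac1j\sum_{n=\underline j}^{j-1}\log\alpha_{s,n}$ for $s\in\mathbb R$ ($\rho$ is either identically $-\infty$ or a decreasing bijection of $\mathbb R$ onto $\mathbb R$) and $d_*=\sup\{s\in\mathbb R:\rho(s)>0\}=\inf\{s\in\mathbb R:\rho(s)<0\}\in[-\infty,\infty)$. Generating functions. For $j\ge0$, $S_j=\{u\in\mathcal U_0:\langle u\rangle=j,\ X_u=1\}$ and $\Phi_j(z)=\mathbb E[z^{\#S_j}]$ (with $0^0=1$). For $t\in\{0,1\}$, $\varphi_{t,j}(z)=\int_{\{0,1\}^{m_j}}z^{x_1+\cdots+x_{m_j}}\,\nu_{t,j}(dx)$. For $j\ge 0$, $f_j=\lim_{n\to\infty}\varphi_{1,j}\circ\cdots\circ\varphi_{1,j+n}(0)$ (a nondecreasing limit). *)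

(* Defs.v *)
From HB Require Import structures.
From mathcomp Require Import all_boot all_order all_algebra finmap.
From mathcomp Require Import all_classical all_reals all_analysis.
From mathcomp Require Import measurable_realfun.

Set Implicit Arguments.
Unset Strict Implicit.
Unset Printing Implicit Defensive.

Import Order.TTheory GRing.Theory Num.Theory.
Import numFieldNormedType.Exports.

Local Open Scope classical_set_scope.
Local Open Scope ring_scope.

Section Probability.
Context {d : measure_display} {Omega : measurableType d} {R : realType}.
Variable P : probability Omega R.

Definition sigma_of_family (I : Type) (D : set I) (d' : measure_display)
    (T : measurableType d') (Y : I -> Omega -> T) : set (set Omega) :=
  <<s \bigcup_(i in D) preimage_set_system setT (Y i) measurable >>.

Definition independent_sigma (F G : set (set Omega)) : Prop :=
  forall A B, F A -> G B -> P (A `&` B) = (P A * P B)%E.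

Definition mutually_independent (I : choiceType) (D : set I)
    (F : I -> set (set Omega)) : Prop :=
  forall s : {fset I}, [set` s] `<=` D ->
  forall A : I -> set Omega, (forall i, i \in s -> F i (A i)) ->
  P (\bigcap_(i in [set` s]) A i) = (\prod_(i <- s) P (A i))%E.

(* [Y] is a version of the conditional probability of [E] given the
   sub-sigma-algebra [G]. *)
Definition is_cond_probability (G : set (set Omega)) (E : set Omega)
    (Y : Omega -> \bar R) : Prop :=
  [/\ preimage_set_system setT Y measurable `<=` G,
      P.-integrable setT Y
    & forall B, G B -> (\int[P]_(w in B) Y w = P (E `&` B))%E].

End Probability.

Section Geometry.
Context {R : realType}.

(* The library norm on ['rV[R]_n] is the max-norm; diameters are Euclidean. *)
Definition euclidean_dist (n : nat) (x y : 'rV[R]_n) : R :=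
  Num.sqrt (\sum_(i < n) (x ord0 i - y ord0 i) ^+ 2).

Definition diam (n : nat) (A : set 'rV[R]_n) : R :=
  sup [set euclidean_dist p.1 p.2 | p in A `*` A].

(* Lebesgue measure on R^n, as an iterated product: the measure of a Borel set
   is the integral of the measures of its slices along the first coordinate. *)
Fixpoint lebesgue_rV (n : nat) : set 'rV[R]_n -> \bar R :=
  match n with
  | 0%N => fun A => (\1_A (0 : 'rV[R]_0))%:E
  | n'.+1 => fun A =>
      (\int[lebesgue_measure]_(x in [set: R])
         lebesgue_rV [set y : 'rV[R]_n' |
                        A (row_mx (x%:M : 'rV[R]_1) y : 'rV[R]_n'.+1)])%E
  end.

End Geometry.

Section Tree.
Variable m : nat -> nat.

(* Words over {1, 2, ...} are [seq nat]; [nth 0 u i] is the letter u_(i+1). *)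
Definition words (j : nat) : set (seq nat) :=
  [set u | forall i, (i < size u)%N -> (1 <= nth 0 u i <= m (j + i))%N].

Definition words1 (j : nat) : set (seq nat) := words j `\ [::].

Definition parent (u : seq nat) : seq nat := take (size u).-1 u.

Definition subtree (u : seq nat) : set (seq nat) :=
  [set u ++ w | w in words (size u)].

Definition subtree1 (u : seq nat) : set (seq nat) :=
  [set u ++ w | w in words1 (size u)].

(* The entry of index [k : 'I_(m <u>)] is attached to the letter [k.+1]. *)
Definition children_values (T Omega : Type) (Y : seq nat -> Omega -> T)
    (u : seq nat) (w : Omega) : (m (size u)).-tuple T :=
  [tuple Y (rcons u k.+1) w | k < m (size u)].

End Tree.

Section Compacts.
Context {d : measure_display} {Omega : measurableType d} {R : realType}.
Variables (P : probability Omega R) (m : nat -> nat) (dim : nat).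
Variable J : seq nat -> Omega -> set 'rV[R]_dim.

Definition diam_ratio (u : seq nat) (w : Omega) : R :=
  diam (J u w) / diam (J (parent u) w).

Definition cube (n : nat) (b1 b2 : R) : set (n.-tuple R) :=
  [set l | forall k, b1 <= tnth l k <= b2].

Definition compact_family : Prop :=
  forall u w, words m 0 u -> compact (J u w) /\ 0 < diam (J u w).

Definition nested_family : Prop :=
  forall u w, words m 0 u ->
    (forall k, (1 <= k <= m (size u))%N -> J (rcons u k) w `<=` J u w) /\
    (forall k l, (1 <= k <= m (size u))%N -> (1 <= l <= m (size u))%N ->
       k <> l -> (J (rcons u k) w)° `&` (J (rcons u l) w)° = set0).

Definition thick_family : Prop :=
  exists2 kappa : R, 0 < kappa &
    forall u w, words m 0 u ->
      ((kappa * diam (J u w) ^+ dim)%:E <= lebesgue_rV (J u w)°)%E.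

Definition random_ratios (mu : forall j, probability ((m j).-tuple R) R) : Prop :=
  [/\ forall u, words1 m 0 u -> measurable_fun setT (diam_ratio u),
      mutually_independent P (words m 0)
        (fun u => preimage_set_system setT (children_values m diam_ratio u) measurable)
    & forall u, words m 0 u ->
        forall A, measurable A ->
          P (children_values m diam_ratio u @^-1` A) = mu (size u) A].

End Compacts.

Section MarkovChain.
Context {d : measure_display} {Omega : measurableType d} {R : realType}.
Variables (P : probability Omega R) (m : nat -> nat).
Variable X : seq nat -> Omega -> bool.

Definition sigma_outside (u : seq nat) : set (set Omega) :=
  sigma_of_family (words m 0 `\` subtree1 m u) X.

Definition tree_markov_chain
    (nu : bool -> forall j, probability ((m j).-tuple bool) R) : Prop :=
  (forall u, words m 0 u -> measurable_fun setT (X u)) /\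
  (forall u (A : set ((m (size u)).-tuple bool)), words m 0 u ->
     is_cond_probability P (sigma_outside u) (children_values m X u @^-1` A)
       (fun w => nu (X u w) (size u) A)).

End MarkovChain.

Section Limit_set.
Context {Omega : Type} {R : realType}.
Variables (m : nat -> nat) (dim : nat).
Variables (J : seq nat -> Omega -> set 'rV[R]_dim) (X : seq nat -> Omega -> bool).

Definition tau (u : seq nat) (w : Omega) : set (seq nat) :=
  [set v | subtree m u v /\
           forall j, (size u <= j <= size v)%N -> X (take j v) w = true].

(* A sequence (zeta_j)_(j >= 1) is coded by [zeta : nat -> nat] with [zeta i]
   standing for zeta_(i+1), so that [mkseq zeta j] is zeta_1 ... zeta_j. *)
Definition boundary (u : seq nat) (w : Omega) : set (nat -> nat) :=
  [set zeta | forall j, (size u <= j)%N -> tau u w (mkseq zeta j)].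

(* Almost surely all these intersections are singletons and [get] returns the
   unique point; on the exceptional null event it returns some arbitrary point. *)
Definition branch_point (w : Omega) (zeta : nat -> nat) : 'rV[R]_dim :=
  get (\bigcap_(j in [set j | (1 <= j)%N]) J (mkseq zeta j) w).

Definition Kset (u : seq nat) (w : Omega) : set 'rV[R]_dim :=
  [set branch_point w zeta | zeta in boundary u w].

Definition Theta (w : Omega) : set 'rV[R]_dim :=
  \bigcup_(u in words m 0) Kset u w.

End Limit_set.

Section Critical_exponent.
Context {R : realType}.
Variables (m : nat -> nat) (b1 b2 : R).
Variables (mu : forall j, probability ((m j).-tuple R) R)
          (nu : bool -> forall j, probability ((m j).-tuple bool) R).

Definition alpha (s : R) (j : nat) : R :=
  \int[nu true j]_(x in [set: (m j).-tuple bool])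
    \int[mu j]_(l in cube b1 b2)
      \sum_(k < m j) tnth l k `^ s * (tnth x k)%:R.

Definition alpha_pos_from : set nat :=
  [set j0 | forall j, (j0 <= j)%N -> 0 < alpha 0 j].

(* Least element of [alpha_pos_from] (meaningful when that set is nonempty). *)
Definition jlow : nat :=
  xget 0%N [set j0 | alpha_pos_from j0 /\
                     forall i, alpha_pos_from i -> (j0 <= i)%N].

Definition rho (s : R) : \bar R :=
  limn_einf (fun j : nat =>
    (j%:R^-1 * \sum_(jlow <= n < j) ln (alpha s n))%:E).

Definition d_star : \bar R :=
  if pselect (exists j0, alpha_pos_from j0) then
    ereal_sup [set s%:E | s in [set s : R | (0 < rho s)%E]]
  else -oo%E.

End Critical_exponent.

Section Generating_functions.
Context {d : measure_display} {Omega : measurableType d} {R : realType}.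
Variables (P : probability Omega R) (m : nat -> nat).
Variable X : seq nat -> Omega -> bool.
Variable nu : bool -> forall j, probability ((m j).-tuple bool) R.

Definition S_ (j : nat) (w : Omega) : set (seq nat) :=
  [set u | [/\ words m 0 u, size u = j & X u w = true]].

(* [S_ j w] is always a finite set. *)
Definition Phi (j : nat) (z : R) : \bar R :=
  ('E_P[fun w => (z ^+ #|` fset_set (S_ j w)|)%R])%E.

Definition phi (t : bool) (j : nat) (z : R) : R :=
  \int[nu t j]_(x in [set: (m j).-tuple bool]) z ^+ (\sum_(k < m j) tnth x k)%N.

Definition ext_prob (j : nat) : R :=
  limn (fun n : nat => foldr (phi true) 0 (iota j n.+1)).

End Generating_functions.

(* Main.v *)
Require Import Defs.
From mathcomp Require Import all_boot all_order all_algebra finmap.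
From mathcomp Require Import all_classical all_reals all_analysis.
From mathcomp Require Import measurable_realfun.

Set Implicit Arguments.
Unset Strict Implicit.
Unset Printing Implicit Defensive.

Import Order.TTheory GRing.Theory Num.Theory.
Import numFieldNormedType.Exports.

Local Open Scope classical_set_scope.
Local Open Scope ring_scope.

(** Theta is a union of images of sets of rays, and an image is empty if and
    only if its source is.  So Theta is empty exactly when no boundary contains
    a ray, which is an event about the marks X.

    Call A_j the event that the boundaries of all the words of length j are
    empty.  A ray below a word u passes through a child of u, so the events A_j
    are decreasing, and their intersection is the event that Theta is empty.
    Both conclusions follow from continuity of P along decreasing sequences
    and from the identity P(A_j) = Phi_j(f_j) ([extinct_level_prob]).

    That identity is the branching property.  By Koenig's lemma
    ([boundary_eq0]) the boundary of u is empty if and only if tau_u dies out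
    within finitely many generations, and one may take the same number n of
    generations for all the finitely many words of length j.  Extinction of u
    within n generations is observable outside the strict subtree of any other
    word of the same length.  Conditioning on the words of a generation one
    after the other ([peel_generation]) therefore yields one factor per marked
    word; inserted into the recursion on n for a single word
    ([extinct_prob]), this makes the factor equal to the n-fold composition of
    the phi's at 0.  So the probability that all words of length j die out
    within n generations is Phi_j at this composition, and n tends to infinity
    by monotone continuity on one side and dominated convergence on the
    other. *)

(** * The marked tree, its rays and its extinction *)

Section Tree.
Variable m : nat -> nat.

Definition children (u : seq nat) : seq (seq nat) :=
  [seq rcons u k.+1 | k <- iota 0 (m (size u))].

Fixpoint level (j : nat) : seq (seq nat) :=
  if j is j'.+1 then flatten [seq children u | u <- level j'] else [:: [::]].

Lemma childrenP u v : reflect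
  (exists2 a, (1 <= a <= m (size u))%N & v = rcons u a) (v \in children u).
Proof.
apply: (iffP mapP) => [[k]|[[//|k] km ->]].
  by rewrite mem_iota add0n => km ->; exists k.+1.
by exists k => //; rewrite mem_iota add0n.
Qed.

Lemma size_children u v : v \in children u -> size v = (size u).+1.
Proof. by case/childrenP => a _ ->; rewrite size_rcons. Qed.

Lemma uniq_children u : uniq (children u).
Proof.
rewrite map_inj_uniq ?iota_uniq// => k l /rcons_inj [].
by [].
Qed.

Lemma words_rcons u a :
  words m 0 (rcons u a) <-> words m 0 u /\ (1 <= a <= m (size u))%N.
Proof.
split=> [uw|[uw ua] i].
  split=> [i iu|].
    by have := uw i; rewrite size_rcons ltnS nth_rcons iu => /(_ (ltnW iu)).
  by have := uw (size u); rewrite size_rcons ltnS nth_rcons ltnn eqxx; exact.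
rewrite size_rcons ltnS leq_eqVlt nth_rcons => /orP[/eqP ->|iu].
  by rewrite ltnn eqxx.
by rewrite iu; exact: uw.
Qed.

Lemma words_children u v : v \in children u -> words m 0 u -> words m 0 v.
Proof. by case/childrenP => a am -> uw; apply/words_rcons. Qed.

Lemma mem_level j u : (u \in level j) <-> words m 0 u /\ size u = j.
Proof.
elim: j u => [|j IH] u /=.
  rewrite inE; split=> [/eqP -> //|[_ /size0nil ->]//].
split=> [/flatten_mapP[v /IH[vw <-] uv]|].
  by split; [exact: words_children vw|exact: size_children].
case/lastP: u => [[]//|u a] [/words_rcons[uw ua]].
rewrite size_rcons => -[uj]; apply/flatten_mapP; exists u; first exact/IH.
by apply/childrenP; exists a.
Qed.

Lemma uniq_level j : uniq (level j).
Proof.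
elim: j => //= j; elim: (level j) => //= u s IH /andP[us su].
rewrite cat_uniq uniq_children IH// andbT /=.
apply/hasPn => v /flatten_mapP[u' u's /childrenP[a _ ->]].
apply/negP => /childrenP[b _ /rcons_inj[uu' _]].
by rewrite -uu' u's in us.
Qed.

Section Extinction.
Variables (Omega : Type) (X : seq nat -> Omega -> bool).

(** [extinct n u w]: no word of length [size u + n] lies in tau_u.  The
    recursion follows the first generation, so that it unfolds along the
    conditional law of the children of [u]. *)
Fixpoint extinct (n : nat) (u : seq nat) (w : Omega) : bool :=
  ~~ X u w ||
  (if n is n'.+1 then all (fun v => extinct n' v w) (children u) else false).

Lemma extinctS n u w : extinct n u w -> extinct n.+1 u w.
Proof.
elim: n u => [|n IH] u /=; first by rewrite orbF => ->.
case: (X u w) => //= /allP h; apply/allP => v /h; exact: IH.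
Qed.

Lemma extinct_le n p u w : (n <= p)%N -> extinct n u w -> extinct p u w.
Proof.
by move/subnK <-; elim: (p - n)%N => // k IH /IH; exact: extinctS.
Qed.

(** Extinction is monotone in the number of generations, so finitely many
    words share a common extinction time. *)
Lemma all_extinctP (s : seq (seq nat)) w :
  (exists n, all (fun u => extinct n u w) s) <->
  forall u, u \in s -> exists n, extinct n u w.
Proof.
split=> [[n /allP h] u /h|]; first by exists n.
elim: s => [|u s IH] h; first by exists 0%N.
have [n nu] := h u (mem_head _ _).
have [|p ps] := IH; first by move=> v vs; apply: h; rewrite inE vs orbT.
exists (maxn n p); rewrite /= (extinct_le _ nu) ?leq_maxl//=.
by apply: sub_all ps => v; apply: extinct_le; rewrite leq_maxr.
Qed.

(** The letter of the ray at position [size u] designates the child. *)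
Lemma boundary_child u w zeta : boundary m X u w zeta ->
  X u w /\ exists2 v, v \in children u & boundary m X v w zeta.
Proof.
move=> bz.
have zu : mkseq zeta (size u) = u.
  have [[z _ zE] _] := bz _ (leqnn _).
  have := congr1 size zE; rewrite size_cat size_mkseq => /eqP.
  by rewrite -[X in _ == X]addn0 eqn_add2l -zE => /nilP ->; rewrite cats0.
split.
  have [_] := bz _ (leqnn _); rewrite size_mkseq => /(_ (size u)).
  by rewrite leqnn zu take_size; exact.
have sub j : (size u < j)%N -> exists z,
    [/\ words m (size u).+1 z, (1 <= zeta (size u) <= m (size u))%N
       & mkseq zeta j = rcons u (zeta (size u)) ++ z].
  move=> uj; have [[z zw zE] _] := bz _ (ltnW uj).
  have zuE : nth 0%N (u ++ z) (size u) = zeta (size u).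
    by rewrite zE nth_mkseq.
  case: z zw zE zuE => [_ /(congr1 size)|a z zw zE].
    by rewrite cats0 size_mkseq => juE; rewrite juE ltnn in uj.
  rewrite nth_cat ltnn subnn /= => az; exists z; split.
  - by move=> i iz; have := zw i.+1 iz; rewrite /= addnS addSn.
  - by have := zw 0%N isT; rewrite /= addn0 az.
  - by rewrite -az cat_rcons.
have [z [_ za _]] := sub _ (ltnSn _).
exists (rcons u (zeta (size u))); first by apply/childrenP; exists (zeta (size u)).
move=> j; rewrite size_rcons => uj; have [_ hX] := bz _ (ltnW uj); split.
  by have [y [yw _ ->]] := sub _ uj; exists y => //; rewrite size_rcons.
by move=> i /andP[ui ij]; apply: hX; rewrite (ltnW _)//= -(size_rcons u (zeta (size u))).
Qed.

(** The compactness step of Koenig's lemma: if every child died out in finite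
    time, the maximum of these times would bound the extinction time of [u]. *)
Lemma surviving_child u w : (forall n, ~~ extinct n u w) ->
  X u w /\ exists2 v, v \in children u & forall n, ~~ extinct n v w.
Proof.
move=> h; split; first by have := h 0%N; rewrite /= orbF negbK.
apply: contrapT => hn.
have /all_extinctP[n ns] : forall v, v \in children u -> exists n, extinct n v w.
  move=> v vu; apply: contrapT => hv; apply: hn; exists v => // n.
  by apply/negP => nv; apply: hv; exists n.
by have := h n.+1; rewrite /= ns orbT.
Qed.

(** Koenig's lemma: from a word that never dies out, repeatedly choosing a child
    that never dies out draws a ray of its boundary. *)
Lemma boundary_eq0 u w :
  boundary m X u w = set0 <-> exists n, extinct n u w.
Proof.
split=> [b0|[n]]; last first.
  elim: n u => [|n IH] u nu; apply/seteqP; split=> // zeta /boundary_child[Xu [v vu bv]].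
    by move: nu; rewrite /= Xu.
  by move: nu; rewrite /= Xu => /allP /(_ _ vu) /IH b0; move: bv; rewrite b0.
apply: contrapT => hn.
pose surv v := forall n, ~~ extinct n v w.
have su : surv u by move=> n; apply/negP => nu; apply: hn; exists n.
have [next nextP] : exists next : seq nat -> nat, forall v, surv v ->
    (1 <= next v <= m (size v))%N /\ surv (rcons v (next v)).
  have /choice[next nextP] : forall v, exists a, surv v ->
      (1 <= a <= m (size v))%N /\ surv (rcons v a).
    move=> v; have [sv|nsv] := pselect (surv v); last by exists 0%N.
    have [_ [v' /childrenP[a am ->] sa]] := surviving_child sv.
    by exists a.
  by exists next.
pose path i := iter i (fun v => rcons v (next v)) u.
pose a i := next (path i).
have pathE i : path i = u ++ mkseq a i.
  elim: i => [|i IH]; first by rewrite cats0.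
  by rewrite mkseqS -rcons_cat -IH.
have surv_path i : surv (path i).
  by elim: i => // i IH; have [_] := nextP _ IH.
have size_path i : size (path i) = (size u + i)%N by rewrite pathE size_cat size_mkseq.
pose zeta i := if (i < size u)%N then nth 0%N u i else a (i - size u)%N.
have zetaE i : mkseq zeta (size u + i) = path i.
  rewrite pathE /mkseq iotaD map_cat add0n; congr (_ ++ _).
    rewrite -[RHS](mkseq_nth 0%N) /mkseq; apply/eq_in_map => l.
    rewrite mem_iota add0n /zeta.
    by move=> /= ->.
  rewrite -[X in iota X _]addn0 iotaDl -map_comp; apply: eq_map => l /=.
  by rewrite /zeta ltnNge leq_addr /= addKn.
suff : boundary m X u w zeta by rewrite b0.
move=> j uj; rewrite -(subnKC uj) zetaE; split.
  exists (mkseq a (j - size u)%N); last by rewrite -pathE.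
  move=> i; rewrite size_mkseq => ij; rewrite nth_mkseq//.
  by have [] := nextP _ (surv_path i); rewrite size_path.
move=> i; rewrite size_path subnKC// => /andP[ui ij].
have -> : take i (path (j - size u)%N) = path (i - size u)%N.
  rewrite -zetaE subnKC// -zetaE subnKC// /mkseq -map_take take_iota.
  by rewrite (minn_idPl ij).
by have [] := surviving_child (@surv_path (i - size u)%N).
Qed.

End Extinction.

Definition extinct_level (Omega : Type) (X : seq nat -> Omega -> bool) (j : nat) :
    set Omega :=
  [set w | forall u, u \in level j -> boundary m X u w = set0].

Lemma nonincreasing_extinct_level (Omega : Type) (X : seq nat -> Omega -> bool) :
  nonincreasing_seq (extinct_level X).
Proof.
apply/nonincreasing_seqP => j; apply/subsetPset => w h u /mem_level[uw uj].
apply/seteqP; split=> // zeta bz; have [_ [v vu bv]] := boundary_child bz.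
suff /h b0 : v \in level j.+1 by move: bv; rewrite /= b0.
by apply/mem_level; rewrite (size_children vu) uj; split=> //; exact: words_children uw.
Qed.

(** The image of a boundary under [branch_point] is empty if and only if the
    boundary is. *)
Lemma Theta_eq0 (Omega : Type) (R : realType) (dim : nat)
    (J : seq nat -> Omega -> set 'rV[R]_dim) (X : seq nat -> Omega -> bool) :
  [set w | Theta m J X w = set0] = \bigcap_j extinct_level X j.
Proof.
apply/seteqP; split=> w h.
  move=> j _ u /mem_level[uw _]; apply/seteqP; split=> // zeta bz.
  suff : Theta m J X w (branch_point J w zeta) by rewrite h.
  by exists u => //; exists zeta.
apply/seteqP; split=> // x [u uw [zeta bz _]].
by move: bz; rewrite (h (size u))//; exact/mem_level.
Qed.

Lemma S_level (d : measure_display) (Omega : measurableType d)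
    (X : seq nat -> Omega -> bool) (j : nat) w :
  #|` fset_set (S_ m X j w)| = count (X ^~ w) (level j).
Proof.
have -> : S_ m X j w = [set` [fset u in [seq u <- level j | X u w]]%fset].
  apply/seteqP; split=> u /=.
    by case=> uw uj Xu; rewrite !inE mem_filter Xu /=; exact/mem_level.
  rewrite !inE mem_filter => /andP[Xu /mem_level[uw uj]].
  by split.
rewrite set_fsetK card_fseq undup_id ?size_filter//.
by rewrite filter_uniq// uniq_level.
Qed.

End Tree.

(** * Closure of sigma-algebras and integration over finite types *)

Section SigmaAlgebraEvents.
Variables (T : Type) (G : set (set T)) (sG : sigma_algebra setT G).

Lemma sigma_algebra_setC A : G A -> G (~` A).
Proof. by rewrite -setTD; case: sG => _ + _; exact. Qed.

Lemma sigma_algebra_setU A B : G A -> G B -> G (A `|` B).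
Proof.
move=> GA GB; have [G0 _ GU] := sG.
by rewrite -bigcup2E; apply: GU => -[|[|n]].
Qed.

Lemma sigma_algebra_setI A B : G A -> G B -> G (A `&` B).
Proof.
move=> GA GB; rewrite -[_ `&` _]setCK setCI.
by apply/sigma_algebra_setC/sigma_algebra_setU; exact: sigma_algebra_setC.
Qed.

Lemma sigma_algebra_all (I : eqType) (s : seq I) (f : I -> T -> bool) :
  (forall i, i \in s -> G [set w | f i w]) ->
  G [set w | all (f ^~ w) s].
Proof.
elim: s => [_|i s IH h] /=.
  rewrite [X in G X](_ : _ = ~` set0); first by apply: sigma_algebra_setC; case: sG.
  by rewrite setC0; apply/seteqP; split.
rewrite [X in G X](_ : _ = [set w | f i w] `&` [set w | all (f ^~ w) s]).
  apply: sigma_algebra_setI; first by apply: h; rewrite mem_head.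
  by apply: IH => j js; apply: h; rewrite inE js orbT.
by apply/seteqP; split=> w /= => [/andP[]|[-> ->]].
Qed.

(** Stated for an arbitrary sigma-algebra because it serves twice: for the
    events of the probability space and for those observable outside a strict
    subtree. *)
Lemma sigma_algebra_extinct (m : nat -> nat) (X : seq nat -> T -> bool) n u :
  words m 0 u ->
  (forall v, words m 0 v -> prefix u v -> G [set w | X v w]) ->
  G [set w | extinct m X n u w].
Proof.
elim: n u => [|n IH] u uw h /=.
  rewrite [X in G X](_ : _ = ~` [set w | X u w]).
    by apply/sigma_algebra_setC/h => //; exact: prefix_refl.
  by apply/seteqP; split=> w /=; rewrite orbF => /negP.
rewrite [X in G X](_ : _ = ~` [set w | X u w] `|`
    [set w | all ((extinct m X n) ^~ w) (children m u)]).
  apply: sigma_algebra_setU.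
    by apply/sigma_algebra_setC/h => //; exact: prefix_refl.
  apply: sigma_algebra_all => v vu; apply: IH; first exact: words_children uw.
  move=> v' v'w vv'; apply: h => //; apply: prefix_trans vv'.
  by move: vu => /childrenP[a _ ->]; exact: prefix_rcons.
apply/seteqP; split=> w /=.
  by case/orP => [/negP|]; [left|right].
by case=> [/negP ->|->] //; rewrite orbT.
Qed.

End SigmaAlgebraEvents.

(** Change of variables for a finite-valued [Y]; it turns both an integral over
    the offspring law and an expectation over the children into finite sums. *)
Lemma ge0_integral_finType (d : measure_display) (T : measurableType d)
    (R : realType) (mu : {measure set T -> \bar R}) (F : finType) (Y : T -> F)
    (h : F -> R) (B : set T) :
  (forall x, measurable (Y @^-1` [set x])) -> measurable B ->
  (forall x, 0 <= h x) ->
  (\int[mu]_(w in B) (h (Y w))%:E =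
   \sum_(x : F) (h x)%:E * mu (Y @^-1` [set x] `&` B))%E.
Proof.
move=> mY mB h0.
transitivity (\int[mu]_(w in B)
    (\sum_(x : F) (h x)%:E * (\1_(Y @^-1` [set x]) w)%:E)%E)%E.
  apply: eq_integral => w _; rewrite (bigD1 (Y w))//= big1 ?adde0.
    by rewrite indicE mem_set ?mule1.
  by move=> x xY; rewrite indicE memNset ?mule0//= => /esym/eqP; exact/negP.
rewrite ge0_integral_sum//.
- apply: eq_bigr => x _; rewrite ge0_integralZl_EFin//.
  + by rewrite integral_indic.
  + exact/measurable_EFinP/measurable_funTS/measurable_indic.
- move=> x; apply: measurable_funeM.
  exact/measurable_EFinP/measurable_funTS/measurable_indic.
- by move=> x w _; apply: mule_ge0; rewrite lee_fin.
Qed.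

Lemma measurable_tuple1 n (x : n.-tuple bool) : measurable [set x].
Proof.
rewrite [X in measurable X](_ : _ =
    [set y : n.-tuple bool | all (fun i => tnth y i == tnth x i) (enum 'I_n)]).
  apply: (@sigma_algebra_all _ _ (sigma_algebra_measurable _)) => i _.
  have := measurable_tnth (T := bool) i measurableT (Y := [set tnth x i]) I.
  rewrite setTI; congr measurable; apply/seteqP; split=> y /= => [->//|].
  by move/eqP.
apply/seteqP; split=> y /= => [->|/allP h]; first exact/allP.
by apply: eq_from_tnth => i; apply/eqP/h; rewrite mem_enum.
Qed.

(** * Offspring generating functions and their compositions *)

Section GeneratingFunction.
Variables (R : realType) (m : nat -> nat).
Variable nu : bool -> forall j, probability ((m j).-tuple bool) R.

(** As a polynomial with nonnegative coefficients, [phi] is visibly monotone. *)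
Lemma phiE t j z : 0 <= z ->
  phi nu t j z = \sum_(x : (m j).-tuple bool)
    z ^+ (\sum_(k < m j) tnth x k)%N * fine (nu t j [set x]).
Proof.
move=> z0; rewrite /phi /Rintegral.
rewrite (@ge0_integral_finType _ _ _ (nu t j) _ id
  (fun x => z ^+ (\sum_(k < m j) tnth x k)%N))//.
- rewrite (eq_bigr (fun x : (m j).-tuple bool =>
    (z ^+ (\sum_(k < m j) tnth x k)%N * fine (nu t j [set x]))%:E)).
    by rewrite sumEFin.
  move=> x _; rewrite preimage_id setIT EFinM fineK// fin_num_measure//.
  exact: measurable_tuple1.
- by move=> x; exact: measurable_tuple1.
- by move=> x; rewrite exprn_ge0.
Qed.

Lemma phi_ge0 t j z : 0 <= z -> 0 <= phi nu t j z.
Proof.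
move=> z0; rewrite phiE//; apply: sumr_ge0 => x _.
by rewrite mulr_ge0 ?exprn_ge0 ?fine_ge0.
Qed.

Lemma le_phi t j y z : 0 <= y -> y <= z -> phi nu t j y <= phi nu t j z.
Proof.
move=> y0 yz; have z0 := le_trans y0 yz; rewrite !phiE//.
by apply: ler_sum => x _; rewrite ler_wpM2r ?fine_ge0// lerXn2r.
Qed.

Lemma phi1 t j : phi nu t j 1 = 1.
Proof.
rewrite /phi; under eq_Rintegral do rewrite expr1n.
rewrite Rintegral_cst// mul1r.
exact: (congr1 fine (probability_setT (nu t j))).
Qed.

(** The probability that a marked word of length [j] dies out within [n]
    generations; it is 0 for [n = 0] because a marked word is itself alive. *)
Definition ext_prob_by (j n : nat) : R := foldr (phi nu true) 0 (iota j n).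

Lemma ext_prob_byS j n : ext_prob_by j n.+1 = phi nu true j (ext_prob_by j.+1 n).
Proof. by []. Qed.

Lemma ext_prob_by_ge0 j n : 0 <= ext_prob_by j n.
Proof. by elim: n j => // n IH j; rewrite ext_prob_byS phi_ge0. Qed.

Lemma ext_prob_by_le1 j n : ext_prob_by j n <= 1.
Proof.
elim: n j => [|n IH] j; first exact: ler01.
by rewrite ext_prob_byS -(phi1 true j) le_phi ?ext_prob_by_ge0.
Qed.

Lemma ext_prob_by_nondecreasing j : nondecreasing_seq (ext_prob_by j).
Proof.
apply/nondecreasing_seqP => n; elim: n j => [|n IH] j; first exact: ext_prob_by_ge0.
by rewrite (ext_prob_byS j n) (ext_prob_byS j n.+1) le_phi ?ext_prob_by_ge0.
Qed.

Lemma cvg_ext_prob_by j : ext_prob_by j @ \oo --> ext_prob nu j.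
Proof.
have : cvgn (ext_prob_by j).
  apply: nondecreasing_is_cvgn; first exact: ext_prob_by_nondecreasing.
  by exists 1 => _ [n _ <-]; exact: ext_prob_by_le1.
rewrite /ext_prob => cq; 
suff -> : limn (fun n => ext_prob_by j n.+1) = limn (ext_prob_by j) by [].
by apply/cvg_lim => //; rewrite (cvg_shiftS (ext_prob_by j)).
Qed.

End GeneratingFunction.

(** * The branching property *)

Section MarkovTree.
Context {d : measure_display} {Omega : measurableType d} {R : realType}.
Variables (P : probability Omega R) (m : nat -> nat).
Variable nu : bool -> forall j, probability ((m j).-tuple bool) R.
Variable X : seq nat -> Omega -> bool.
Hypothesis hX : tree_markov_chain P X nu.

Notation G := (sigma_outside m X).

Lemma sigma_algebra_outside u : sigma_algebra setT (G u).
Proof. exact: smallest_sigma_algebra. Qed.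

Lemma subtree1_prefix u v : subtree1 m u v -> prefix u v /\ (size u < size v)%N.
Proof.
case=> z [_ z0] <-; rewrite prefix_prefix size_cat -[X in (X < _)%N]addn0 ltn_add2l.
by split=> //; case: z z0 => // /(_ erefl).
Qed.

Lemma outside_X u v : words m 0 v -> ~ subtree1 m u v -> G u [set w | X v w].
Proof.
move=> vw uv; apply: sub_sigma_algebra; exists v => //=.
by exists [set true] => //; rewrite setTI.
Qed.

Lemma outside_measurable u A : G u A -> measurable A.
Proof.
apply: smallest_sub; first exact: sigma_algebra_measurable.
by move=> B [v [vw _] [C mC <-]]; exact: (hX.1 v vw).
Qed.

Lemma measurable_X u : words m 0 u -> measurable [set w | X u w].
Proof.
move=> uw; apply: (@outside_measurable u); apply: outside_X => //.
by move=> /subtree1_prefix[_]; rewrite ltnn.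
Qed.

(** Two words of the same length are prefixes of no common word, so the fate of
    one is observable outside the strict subtree of the other: this is what
    lets the words of a generation be conditioned upon one at a time. *)
Lemma outside_extinct u v n : words m 0 v -> size v = size u -> v != u ->
  G u [set w | extinct m X n v w].
Proof.
move=> vw vu neq; apply: (sigma_algebra_extinct (sigma_algebra_outside u)) => //.
move=> v' v'w; rewrite prefixE => /eqP vv'; apply: outside_X => //.
move=> /subtree1_prefix[]; rewrite prefixE -vu vv' => /eqP vuE.
by rewrite vuE eqxx in neq.
Qed.

(** The strict subtree of a child is part of that of its parent, hence what is
    known when revealing the children remains known when revealing their own
    subtrees. *)
Lemma outside_child u v : v \in children m u -> G u `<=` G v.
Proof.
move=> vu; apply: smallest_sub; first exact: sigma_algebra_outside.
move=> B [v' [v'w uv'] hB]; apply: sub_sigma_algebra; exists v' => //; split=> //.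
move: vu => /childrenP[a am ->] [z [zw _] zE]; apply: uv'; exists (a :: z).
  split=> // -[|i] /=; first by rewrite addn0.
  by rewrite ltnS => /zw; rewrite size_rcons addnS addSn.
by rewrite -zE cat_rcons.
Qed.

Lemma measurable_extinct n u : words m 0 u -> measurable [set w | extinct m X n u w].
Proof.
move=> uw; apply: (sigma_algebra_extinct (sigma_algebra_measurable _)) => // v vw _.
exact: measurable_X.
Qed.

Lemma measurable_all_extinct n s : (forall u, u \in s -> words m 0 u) ->
  measurable [set w | all (fun u => extinct m X n u w) s].
Proof.
move=> sw; apply: (sigma_algebra_all (sigma_algebra_measurable _)) => u /sw.
exact: measurable_extinct.
Qed.

Lemma measurable_expr_count (z : R) s : (forall u, u \in s -> words m 0 u) ->
  measurable_fun setT (fun w => z ^+ count (X ^~ w) s).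
Proof.
move=> sw.
rewrite [X in measurable_fun _ X](_ : _ =
    fun w => \prod_(u <- s) (if X u w then z else 1)).
  apply: measurable_prod => u /sw uw; apply: measurable_fun_ifT => //.
  exact: hX.1.
apply/funext => w; rewrite -big_mkcond big_const_seq.
by rewrite -[RHS]/(iter _ (GRing.mul z) 1) iter_mulr_1.
Qed.

(** Conditioning on the words of [s] one at a time.  A word [u] with mark 0
    is extinct and contributes a factor 1.  If its mark is 1, the event that the
    remaining words die out is observable outside the strict subtree of [u], so
    [u] contributes the factor [z]; the exponent counts the marks. *)
Lemma peel_generation (j n : nat) (z : R) (s : seq (seq nat)) (B : set Omega) :
  0 <= z ->
  (forall u A, u \in s -> G u A -> A `<=` [set w | X u w] ->
     P (A `&` [set w | extinct m X n u w]) = (z%:E * P A)%E) ->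
  uniq s -> (forall u, u \in s -> words m 0 u /\ size u = j) ->
  (forall u, u \in s -> G u B) -> measurable B ->
  P (B `&` [set w | all (fun u => extinct m X n u w) s]) =
  (\int[P]_(w in B) (z ^+ count (X ^~ w) s)%:E)%E.
Proof.
move=> z0; elim: s B => [|u s IH] B hz.
  move=> _ _ _ mB; rewrite (integral_cst P mB 1%:E) mul1e; congr (P _).
  by apply/seteqP; split=> // w [].
move=> /= /andP[us uniqs] sw GB mB.
have sw' v : v \in s -> words m 0 v /\ size v = j.
  by move=> vs; apply: sw; rewrite inE vs orbT.
have {}IH := IH _ (fun v A vs => hz v A (@mem_behead _ (u :: s) v vs)) uniqs sw'.
have [uw uj] := sw u (mem_head _ _).
have mXu := measurable_X uw.
(* Split according to the mark of [u]: marked on [B1], unmarked on [B0]. *)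
pose B1 := B `&` [set w | X u w]; pose B0 := B `&` ~` [set w | X u w].
have mB1 : measurable B1 by exact: measurableI.
have mB0 : measurable B0 by apply: measurableI => //; exact: measurableC.
have GXu v : v \in s -> G v [set w | X u w].
  move=> /sw'[_ vj]; apply: outside_X => // /subtree1_prefix[_].
  by rewrite uj vj ltnn.
have GB1 v : v \in s -> G v B1.
  move=> vs; apply: (sigma_algebra_setI (sigma_algebra_outside v)) (GXu _ vs).
  by apply: GB; rewrite inE vs orbT.
have GB0 v : v \in s -> G v B0.
  move=> vs; apply: (sigma_algebra_setI (sigma_algebra_outside v)).
    by apply: GB; rewrite inE vs orbT.
  by apply: sigma_algebra_setC (GXu _ vs); exact: sigma_algebra_outside.
pose E := [set w | all (fun u => extinct m X n u w) s].
have mE : measurable E by apply: measurable_all_extinct => v /sw'[].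
have GuE : G u E.
  apply: (sigma_algebra_all (sigma_algebra_outside u)) => v vs.
  have [vw vj] := sw' v vs; apply: outside_extinct => //; first by rewrite vj.
  by apply: contraNneq us => <-.
have GuB1 : G u (B1 `&` E).
  apply: (sigma_algebra_setI (sigma_algebra_outside u)) => //.
  apply: (sigma_algebra_setI (sigma_algebra_outside u)).
    by apply: GB; rewrite mem_head.
  by apply: outside_X => // /subtree1_prefix[_]; rewrite ltnn.
have BE : B = B1 `|` B0 by rewrite /B1 /B0 -setIUr setUv setIT.
have mint (z' : R) D : measurable_fun D (fun w => (z' ^+ count (X ^~ w) s)%:E).
  apply/measurable_EFinP/measurable_funTS/measurable_expr_count.
  by move=> v /sw'[].
rewrite [in RHS]BE ge0_integral_setU//; last 3 first.
- apply/measurable_EFinP/measurable_funTS/(measurable_expr_count z (s := u :: s)).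
  by move=> v /sw[].
- by move=> w _; rewrite lee_fin exprn_ge0.
- by apply/disj_setPS => w [[_ ?] [_]].
have -> : B `&` [set w | extinct m X n u w && all (fun u => extinct m X n u w) s] =
    (B1 `&` E `&` [set w | extinct m X n u w]) `|` (B0 `&` E).
  apply/seteqP; split=> w /=.
    move=> [Bw /andP[uw' sw'']]; case: (boolP (X u w)) => Xu; [left|right] => //.
    by split=> //; split=> //; exact/negP.
  case=> [[[[Bw _]] ->] ->//|[[Bw Xu] Ew]]; split=> //; rewrite Ew andbT.
  by case: (n) => [|n'] /=; move/negP: Xu => ->.
rewrite measureU; last 3 first.
- by apply: measurableI; [exact: measurableI|exact: measurable_extinct].
- exact: measurableI.
- by apply/seteqP; split=> // w [[[[_ ?] _] _] [[_]]].
congr (_ + _)%E.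
- apply: etrans (hz _ _ (mem_head _ _) GuB1 _) _; first by move=> w [[_]].
  rewrite IH//. rewrite -ge0_integralZl_EFin//.
    by apply: eq_integral => w; rewrite inE => -[_ /= ->]; rewrite exprS.
  by move=> w _; rewrite lee_fin exprn_ge0.
- apply: (etrans (IH _ GB0 mB0)); apply: eq_integral => w.
  by rewrite inE => -[_ /= /negP/negbTE ->].
Qed.

(** A marked word dies out within [n.+1] generations if and only if all its
    children die out within [n]; peeling the children and then integrating over
    their conditional law composes with one more generating function. *)
Lemma extinct_prob (n : nat) u (B : set Omega) : words m 0 u -> G u B ->
  B `<=` [set w | X u w] ->
  P (B `&` [set w | extinct m X n u w]) = ((ext_prob_by nu (size u) n)%:E * P B)%E.
Proof.
elim: n u B => [|n IH] u B uw GB BX.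
  rewrite mul0e [X in P X](_ : _ = set0) ?measure0//.
  by apply/seteqP; split=> // w [/BX /= ->].
have mB := outside_measurable GB.
transitivity (P (B `&` [set w | all (fun v => extinct m X n v w) (children m u)])).
  by congr (P _); apply/seteqP; split=> w /= [Bw]; have /= -> := BX w Bw.
rewrite (@peel_generation (size u).+1 n (ext_prob_by nu (size u).+1 n)); last 6 first.
- exact: ext_prob_by_ge0.
- move=> v A vu GA AX; rewrite -(size_children vu); apply: IH => //.
  exact: words_children uw.
- exact: uniq_children.
- by move=> v vu; rewrite (size_children vu); split=> //; exact: words_children uw.
- by move=> v vu; exact: outside_child GB.
- by [].
set z := ext_prob_by nu _ n.
have z0 : 0 <= z by exact: ext_prob_by_ge0.
have mY (x : (m (size u)).-tuple bool) :
    measurable (children_values m X u @^-1` [set x]).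
  rewrite -[X in measurable X]setTI.
  apply: (_ : measurable_fun setT (children_values m X u)) => //.
    apply/measurable_fun_tnthP => i.
    rewrite (_ : _ \o _ = X (rcons u i.+1)); last first.
      by apply/funext => w /=; rewrite tnth_mktuple.
    by apply: hX.1; apply/words_rcons; split=> //=; exact: ltn_ord.
  exact: measurable_tuple1.
transitivity (\int[P]_(w in B)
    (z ^+ (\sum_(k < m (size u)) tnth (children_values m X u w) k)%N)%:E)%E.
  apply: eq_integral => w _; congr ((_ ^+ _)%:E).
  rewrite /children count_map -sum1_count big_mkcond.
  have -> : iota 0 (m (size u)) = index_iota 0 (m (size u)).
    by rewrite /index_iota subn0.
  rewrite big_mkord; apply: eq_bigr => k _.
  by rewrite tnth_mktuple /=; case: ifP.
rewrite (@ge0_integral_finType _ _ _ P _ (children_values m X u)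
  (fun x => z ^+ (\sum_(k < m (size u)) tnth x k)%N))//; last first.
  by move=> x; rewrite exprn_ge0.
rewrite ext_prob_byS phiE// -sumEFin ge0_sume_distrl; last first.
  by move=> x _; rewrite lee_fin mulr_ge0 ?exprn_ge0 ?fine_ge0.
apply: eq_bigr => x _; rewrite EFinM -muleA; congr (_ * _)%E.
have [_ _ condX] := hX.2 u [set x] uw.
apply: etrans (esym (condX B GB)) _.
rewrite fineK ?fin_num_measure//; last exact: measurable_tuple1.
transitivity (\int[P]_(w in B) (nu true (size u) [set x]))%E.
  by apply: eq_integral => w; rewrite inE => /BX /= ->.
exact: (integral_cst P mB).
Qed.

End MarkovTree.

(** * Passage to the limit *)

Section LimitSet.
Context {d : measure_display} {Omega : measurableType d} {R : realType}.
Variables (P : probability Omega R) (m : nat -> nat).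
Variable nu : bool -> forall j, probability ((m j).-tuple bool) R.
Variable X : seq nat -> Omega -> bool.
Hypothesis hX : tree_markov_chain P X nu.

Lemma PhiE j (z : R) :
  Phi P m X j z = (\int[P]_w (z ^+ count (X ^~ w) (level m j))%:E)%E.
Proof.
rewrite /Phi unlock; apply: eq_integral => w _.
by rewrite S_level.
Qed.

Lemma all_extinct_prob j n :
  P [set w | all (fun u => extinct m X n u w) (level m j)] =
  Phi P m X j (ext_prob_by nu j n).
Proof.
rewrite PhiE -(setTI [set w | _]).
apply: (peel_generation hX (j := j)).
- exact: ext_prob_by_ge0.
- by move=> u A /mem_level[uw <-]; exact: (extinct_prob hX).
- exact: uniq_level.
- by move=> u /mem_level.
- move=> u _; rewrite -setC0; apply: (sigma_algebra_setC (sigma_algebra_outside m X u)).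
  by case: (sigma_algebra_outside m X u).
- exact: measurableT.
Qed.

Lemma cvg_Phi j (z_ : nat -> R) (z : R) : (forall n, 0 <= z_ n <= 1) ->
  z_ @ \oo --> z -> (fun n => Phi P m X j (z_ n)) @ \oo --> Phi P m X j z.
Proof.
move=> z01 cz; under eq_fun do rewrite PhiE; rewrite PhiE.
have mint y : measurable_fun setT
    (fun w => (y ^+ count (X ^~ w) (level m j))%:E : \bar R).
  by apply/measurable_EFinP/(measurable_expr_count hX) => u /mem_level[].
have pointwise : {ae P, forall w, setT w ->
    (fun n => (z_ n ^+ count (X ^~ w) (level m j))%:E) @ \oo -->
    (z ^+ count (X ^~ w) (level m j))%:E}.
  apply: aeW => w _; apply: cvg_EFin; first exact: nearW.
  have := continuous_cvg _ (@exprn_continuous R (count (X ^~ w) (level m j)) z) cz.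
  exact.
have dominated : {ae P, forall w n, setT w ->
    (`|(z_ n ^+ count (X ^~ w) (level m j))%:E| <= cst 1 w)%E}.
  apply: aeW => w n _; have /andP[z0 z1] := z01 n.
  by rewrite /= lee_fin ger0_norm ?exprn_ge0// exprn_ile1.
have int1 : P.-integrable setT (cst 1%E) by exact: finite_measure_integrable_cst.
by have [] := dominated_convergence measurableT (fun n => mint (z_ n)) (mint z)
  pointwise int1 dominated.
Qed.

Lemma extinct_levelE j : extinct_level m X j =
  \bigcup_n [set w | all (fun u => extinct m X n u w) (level m j)].
Proof.
apply/seteqP; split=> w.
  move=> h; have [|n nE] := (all_extinctP m X (level m j) w).2; last by exists n.
  by move=> u /h /boundary_eq0.
move=> [n _ nE] u uj; apply/boundary_eq0.
by apply: (all_extinctP m X (level m j) w).1 uj; exists n.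
Qed.

Lemma measurable_extinct_level j : measurable (extinct_level m X j).
Proof.
rewrite extinct_levelE; apply: bigcupT_measurable => n.
by apply: (measurable_all_extinct hX) => u /mem_level[].
Qed.

Lemma extinct_level_prob j :
  P (extinct_level m X j) = Phi P m X j (ext_prob nu j).
Proof.
have cP : (fun n => Phi P m X j (ext_prob_by nu j n)) @ \oo --> P (extinct_level m X j).
  under eq_fun do rewrite -all_extinct_prob.
  have mE n : measurable [set w | all (fun u => extinct m X n u w) (level m j)].
    by apply: (measurable_all_extinct hX) => u /mem_level[].
  rewrite extinct_levelE; apply: nondecreasing_cvg_mu => //.
    exact: bigcupT_measurable.
  apply/nondecreasing_seqP => n; apply/subsetPset => w /=.
  by apply: sub_all => u; exact: extinctS.
apply: (cvg_unique _ cP) => //.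
by apply: cvg_Phi (@cvg_ext_prob_by _ _ _ _) => n; rewrite ext_prob_by_ge0 ext_prob_by_le1.
Qed.

End LimitSet.

Theorem theorem2 (R : realType) (d : measure_display) (Omega : measurableType d)
    (P : probability Omega R)
    (m : nat -> nat) (hm : forall j, (2 <= m j)%N)
    (dim : nat) (hdim : (1 <= dim)%N)
    (b1 b2 : R) (hb1 : 0 < b1) (hb : b1 <= b2) (hb2 : b2 < 1)
    (mu : forall j, probability ((m j).-tuple R) R)
    (hmu : forall j, mu j (cube b1 b2) = 1%E)
    (J : seq nat -> Omega -> set 'rV[R]_dim)
    (hJ : compact_family m J)
    (hJA : nested_family m J)
    (hJB : thick_family m J)
    (hJC : random_ratios P J mu)
    (nu : bool -> forall j, probability ((m j).-tuple bool) R)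
    (X : seq nat -> Omega -> bool)
    (hX : tree_markov_chain P X nu)
    (hXL : independent_sigma P (sigma_of_family (words m 0) X)
                               (sigma_of_family (words1 m 0) (diam_ratio J)))
    (hd : (0 <= d_star b1 b2 mu nu)%E) :
  nonincreasing_seq (fun j => Phi P m X j (ext_prob nu j)) /\
  (fun j => Phi P m X j (ext_prob nu j)) @ \oo
    --> P [set w | Theta m J X w = set0].
Proof.
rewrite Theta_eq0.
rewrite (_ : (fun j => _) = P \o extinct_level m X); last first.
  by apply/funext => j; rewrite /= -(extinct_level_prob hX).
have mE j := measurable_extinct_level hX j.
split.
  move=> i j ij; apply: le_measure; rewrite ?inE//.
  by have /subsetPset := nonincreasing_extinct_level m X ij.
apply: nonincreasing_cvg_mu => //.
- by rewrite -ge0_fin_numE// fin_num_measure.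
- exact: bigcapT_measurable.
- exact: nonincreasing_extinct_level.
Qed.
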